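(* The only powers of $2$ that can be written as the sum of twenty-five or fewer distinct powers of $3$ are $$2^0 = 3^0,\qquad 2^2 = 3^0+3^1,\qquad 2^8 = 3^0+3^1+3^2+3^5.$$ That is, for an integer $x\ge 0$, there exist an integer $n$ with $1\le n\le 25$ and integers $0\le a_1<\cdots<a_n$ such that $$2^x = 3^{a_1}+\cdots+3^{a_n}$$ if and only if $x\in\{0,2,8\}$, and in these cases the representations are the ones displayed above.
   Context: A power of $2$ (respectively, of $3$) means an integer $2^a$ (respectively, $3^a$) with $a\ge 0$ an integer; in particular $1$ is a power of $2$ and a power of $3$. *)

(* Defs.v *)
From mathcomp Require Import all_boot.

Set Implicit Arguments.
Unset Strict Implicit.
Unset Printing Implicit Defensive.

(* [a] lists the exponents a_1 < ... < a_n of a representation of 2 ^ x as a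
   sum of n = size a distinct powers of 3, with 1 <= n <= N. *)
Definition sum_distinct_pow3 (N x : nat) (a : seq nat) : Prop :=
  [/\ 1 <= size a <= N, sorted ltn a & 2 ^ x = \sum_(i <- a) 3 ^ i].

(* Main.v *)
(* Suppose N = 2^x is a sum of at most 25 distinct powers of 3. The k lowest
   ternary digits of N are 0 or 1; let w of them be 1 and let l be their value.
   Then N - l is a sum of at most 25 - w powers of 3, and since 3^d = 1 modulo
   3^d - 1, folding exponents modulo d shows that the residue of N - l modulo
   3^d - 1 has ternary digit sum at most 25 - w (or is 0, which costs 2d). For a
   random residue this digit sum is about d, so for d > 25 the condition is
   rarely met; and it depends only on x modulo the order of 2 modulo
   3^k (3^d - 1). Starting from x mod 1 and refining the modulus e of x by small
   factors, the few classes of x that survive are eventually all ruled out. *)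

Require Import Defs.
From mathcomp Require Import all_boot.
From Stdlib Require Import NArith.
From mathcomp Require Import zify.

(** * Sums of powers of 3 and their ternary digits *)

Definition sum3 (a : seq nat) : nat := \sum_(i <- a) 3 ^ i.

Lemma sum3_cat a b : sum3 (a ++ b) = sum3 a + sum3 b.
Proof. by rewrite /sum3 big_cat. Qed.

Lemma sum3_nseq0 c : sum3 (nseq c 0) = c.
Proof. by rewrite /sum3 big_nseq iter_addn_0 mul1n. Qed.

Lemma sum3_shift k b : sum3 [seq i + k | i <- b] = 3 ^ k * sum3 b.
Proof.
rewrite /sum3 big_map big_distrr /=; apply: eq_bigr => i _.
by rewrite expnD mulnC.
Qed.

(** Exponents of what is left after the units are removed and the sum is divided by 3. *)
Definition unshift (a : seq nat) := [seq i.-1 | i <- a & i != 0].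

Lemma size_unshift a : size a = count_mem 0 a + size (unshift a).
Proof. by rewrite size_map size_filter -(count_predC (pred1 0) a). Qed.

Lemma sum3_unshift a : sum3 a = count_mem 0 a + 3 * sum3 (unshift a).
Proof.
elim: a => [|[|i] a IH]; first by rewrite /sum3 big_nil.
  by rewrite [LHS]/sum3 big_cons -/(sum3 a) IH /= addnA.
rewrite [LHS]/sum3 big_cons -/(sum3 a) IH [in RHS]/sum3 /= big_cons.
by rewrite -/(sum3 (unshift a)) mulnDr -expnS addnCA.
Qed.

Lemma uniq_unshift a : uniq a -> uniq (unshift a).
Proof.
move=> Ua; rewrite map_inj_in_uniq ?filter_uniq // => i j.
by rewrite !mem_filter; case: i j => [|i] [|j] //= _ _ ->.
Qed.

Lemma mem_unshift k a : (k \in unshift a) = (k.+1 \in a).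
Proof.
apply/mapP/idP => [[[|i]] | ka]; rewrite ?mem_filter //= ?mem_filter //.
  by move=> ia ->.
by exists k.+1; rewrite ?mem_filter.
Qed.

Lemma sum3_uniq a : uniq a -> sum3 a = (0 \in a) + 3 * sum3 (unshift a).
Proof. by move=> Ua; rewrite sum3_unshift count_uniq_mem. Qed.

Lemma sum3_mod a : uniq a -> sum3 a %% 3 = (0 \in a).
Proof. by move/sum3_uniq=> ->; case: (0 \in a); lia. Qed.

Lemma sum3_div a : uniq a -> sum3 a %/ 3 = sum3 (unshift a).
Proof. by move/sum3_uniq=> ->; case: (0 \in a); lia. Qed.

Lemma sum3_digit k a : uniq a -> sum3 a %/ 3 ^ k %% 3 = (k \in a).
Proof.
elim: k a => [|k IH] a Ua; first by rewrite divn1 sum3_mod.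
by rewrite expnS divnMA sum3_div // IH ?uniq_unshift // mem_unshift.
Qed.

(** Without repetitions, the ternary digit in place [k] tells whether [k] is an exponent. *)
Lemma sum3_inj a b : sorted ltn a -> sorted ltn b -> sum3 a = sum3 b -> a = b.
Proof.
move=> Sa Sb eq_ab; have [Ua Ub] := (sorted_uniq ltn_trans ltnn Sa,
  sorted_uniq ltn_trans ltnn Sb).
apply: (irr_sorted_eq ltn_trans ltnn Sa Sb) => k.
by have:= sum3_digit k _ Ua; rewrite eq_ab sum3_digit //; do 2!case: (k \in _).
Qed.

(** * Ternary digit sums and folding modulo [3 ^ d - 1] *)

Fixpoint digsum f n := if f is f'.+1 then n %% 3 + digsum f' (n %/ 3) else 0.

(** Exponents may repeat here; a carry trades three equal powers for one, so it only shortens the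
    list. *)
Lemma digsum_le f a : digsum f (sum3 a) <= size a.
Proof.
elim: f a => //= f IH a; rewrite sum3_unshift size_unshift.
set c := count_mem 0 a; set m := sum3 _.
have -> : (c + 3 * m) %% 3 = c %% 3 by lia.
have -> : (c + 3 * m) %/ 3 = m + c %/ 3 by lia.
have := IH (unshift a ++ nseq (c %/ 3) 0).
by rewrite sum3_cat sum3_nseq0 size_cat size_nseq -/m; lia.
Qed.

Lemma digsumP f n : n < 3 ^ f -> exists2 a, sum3 a = n & size a = digsum f n.
Proof.
elim: f n => [|f IH] n /=.
  by rewrite ltnS leqn0 => /eqP ->; exists [::]; rewrite // /sum3 big_nil.
rewrite expnS mulnC -ltn_divLR // => /IH [a sa za].
exists (nseq (n %% 3) 0 ++ [seq i + 1 | i <- a]).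
  by rewrite sum3_cat sum3_nseq0 sum3_shift sa; lia.
by rewrite size_cat size_nseq size_map za.
Qed.

Lemma digsumD d f n :
  digsum (d + f) n = digsum d (n %% 3 ^ d) + digsum f (n %/ 3 ^ d).
Proof.
elim: d n => [|d IH] n; first by rewrite divn1.
rewrite addSn /= IH expnS divnMA addnA; congr (_ + _ + _).
  by rewrite modn_dvdm // dvdn_mulr.
by rewrite [3 * _]mulnC -modn_divl.
Qed.

Lemma digsum_predX d : digsum d (3 ^ d).-1 = 2 * d.
Proof.
elim: d => //= d IH.
have Hd : 0 < 3 ^ d by rewrite expn_gt0.
have -> : (3 ^ d.+1).-1 = (3 ^ d).-1 * 3 + 2 by rewrite expnS; lia.
by rewrite modnMDl divnMDl // addn0 IH; lia.
Qed.

(** Replacing [q * 3 ^ d + r] by [q + r] keeps the residue and lowers the value; the digits of [q]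
    and [r] together are those of the old sum, so no terms are gained. The value stays positive, so
    residue 0 ends at [3 ^ d - 1]. *)
Lemma sum3_fold d a : 0 < d -> 0 < sum3 a -> exists b,
  [/\ size b <= size a, 0 < sum3 b <= (3 ^ d).-1 &
      sum3 b = sum3 a %[mod (3 ^ d).-1]].
Proof.
move=> d0; have [n] := ubnP (sum3 a); elim: n a => // n IH a le_an a0.
have [small | big] := leqP (sum3 a) (3 ^ d).-1.
  by exists a; rewrite a0 small.
have Hd : 2 < 3 ^ d by rewrite (@leq_exp2l 3 1).
set m := sum3 a in le_an a0 big *.
have q0 : 0 < m %/ 3 ^ d by rewrite divn_gt0; lia.
have [f Hf] : exists f, m %/ 3 ^ d < 3 ^ f by exists (m %/ 3 ^ d); rewrite ltn_expl.
have [bq sbq zbq] := digsumP _ _ Hf.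
have [br sbr zbr] : exists2 a, sum3 a = m %% 3 ^ d & size a = digsum d (m %% 3 ^ d).
  by apply: digsumP; rewrite ltn_mod expn_gt0.
have sb : sum3 (bq ++ br) = m %/ 3 ^ d + m %% 3 ^ d by rewrite sum3_cat sbq sbr.
have Em := divn_eq m (3 ^ d).
have Em' : m = (m %/ 3 ^ d) * (3 ^ d).-1 + sum3 (bq ++ br).
  rewrite sb {1}Em addnA -mulnSr prednK //; lia.
have [||b [zb bM Eb]] := IH (bq ++ br); [nia | lia |].
exists b; split=> //; last by rewrite Eb [in RHS]Em' modnMDl.
apply: leq_trans zb _; rewrite size_cat zbq zbr addnC -digsumD.
exact: digsum_le.
Qed.

(** * The lowest ternary digits; [None] signals a digit 2 *)

Fixpoint low k n : option nat :=
  if k is k'.+1 then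
    match n %% 3 with
    | 0 => low k' (n %/ 3)
    | 1 => omap S (low k' (n %/ 3))
    | _ => None
    end
  else Some 0.

Lemma low_mod k j n : k <= j -> low k (n %% 3 ^ j) = low k n.
Proof.
elim: k j n => // k IH [|j] n //; rewrite ltnS => kj /=.
rewrite expnS modn_dvdm ?dvdn_mulr // [3 * _]mulnC -modn_divl IH //.
Qed.

(** The [w] exponents below [k] make up the low digits; [b] is the list of the others, lowered by
    [k]. *)
Lemma lowP k a : uniq a -> exists w b,
  [/\ low k (sum3 a) = Some w, size a = w + size b &
      sum3 a = sum3 a %% 3 ^ k + 3 ^ k * sum3 b].
Proof.
elim: k a => [|k IH] a Ua /=.
  by exists 0, a; rewrite modn1 mul1n.
have [w [b [lw sw eb]]] := IH _ (uniq_unshift _ Ua).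
have E := sum3_uniq _ Ua.
exists ((0 \in a) + w), b; split.
- by rewrite sum3_mod // sum3_div // lw; case: (0 \in a).
- by rewrite size_unshift count_uniq_mem // sw addnA.
have -> : sum3 a %% 3 ^ k.+1 = (0 \in a) + 3 * (sum3 (unshift a) %% 3 ^ k).
  rewrite E {1}(divn_eq (sum3 (unshift a)) (3 ^ k)) mulnDr addnCA mulnCA.
  rewrite -expnS modnMDl modn_small // expnS.
  have := ltn_pmod (sum3 (unshift a)) (expn_gt0 3 k : 0 < 3 ^ k).
  by case: (0 \in a); lia.
by rewrite {1}E {1}eb mulnDr mulnA -expnS addnA.
Qed.

(** * Ternary digits computed on binary numbers *)

(** Long division in base 2: appending a bit doubles quotient and remainder, then reduces the
    latter. *)
Fixpoint div3 (p : positive) : N * nat :=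
  match p with
  | xH => (N0, 1)
  | xO p' => let (q, r) := div3 p' in
    match r with
    | 0 => (N.double q, 0)
    | 1 => (N.double q, 2)
    | _ => (N.succ_double q, 1)
    end
  | xI p' => let (q, r) := div3 p' in
    match r with
    | 0 => (N.double q, 1)
    | 1 => (N.succ_double q, 0)
    | _ => (N.succ_double q, 2)
    end
  end.

Lemma div3P p : N.to_nat (Npos p) = 3 * N.to_nat (div3 p).1 + (div3 p).2
                /\ (div3 p).2 < 3.
Proof.
elim: p => [p [E lt_r]|p [E lt_r]|] //=; case: (div3 p) E lt_r => q [|[|[|r]]] //=;
  lia.
Qed.

Fixpoint digsumN f (n : N) : nat :=
  match f, n with
  | f'.+1, Npos p => let (q, r) := div3 p in r + digsumN f' q
  | _, _ => 0
  end.

Lemma digsumNE f n : digsumN f n = digsum f (N.to_nat n).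
Proof.
elim: f n => // f IH [|p]; first by rewrite -[RHS]/(digsum f 0) -(IH N0); case: f {IH}.
rewrite [LHS]/= [digsum _ _]/=; have [E lt_r] := div3P p.
case: (div3 p) E lt_r => q r /= -> lt_r; rewrite IH.
by congr (_ + digsum _ _); lia.
Qed.

Fixpoint lowN k (n : N) : option nat :=
  if k is k'.+1 then
    if n is Npos p then
      let (q, r) := div3 p in
      match r with
      | 0 => lowN k' q
      | 1 => omap S (lowN k' q)
      | _ => None
      end
    else Some 0
  else Some 0.

Lemma lowNE k n : lowN k n = low k (N.to_nat n).
Proof.
elim: k n => // k IH [|p]; first by rewrite -[RHS]/(low k 0) -(IH N0); case: k {IH}.
rewrite [LHS]/= [low _ _]/=; have [E lt_r] := div3P p.
case: (div3 p) E lt_r => q r /= -> lt_r; rewrite IH.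
have -> : (3 * N.to_nat q + r) %% 3 = r by lia.
by have -> : (3 * N.to_nat q + r) %/ 3 = N.to_nat q by lia.
Qed.

Lemma to_nat_mod m n : N.to_nat (N.modulo m n) = N.to_nat m %% N.to_nat n.
Proof.
case: n => [|p]; first by rewrite N.mod_0_r modn0.
have lt_r : (N.modulo m (Npos p) < Npos p)%num by apply: N.mod_lt.
have -> : N.to_nat m = N.to_nat (N.div m (Npos p)) * N.to_nat (Npos p)
                        + N.to_nat (N.modulo m (Npos p)).
  have := N.div_mod' m (Npos p); lia.
by rewrite modnMDl modn_small //; lia.
Qed.

Lemma to_nat_pow m n : N.to_nat (N.pow m n) = N.to_nat m ^ N.to_nat n.
Proof.
elim/N.peano_ind: n => // n IH.
by rewrite N.pow_succ_r' N2Nat.inj_mul N2Nat.inj_succ expnS IH.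
Qed.

(** * Moduli, residues of powers of 2, shifts of exponents *)

Definition low_modulus := Eval vm_compute in (3 ^ 13)%num.

Definition fold_moduli : seq (nat * N) :=
  Eval vm_compute in
    [seq (d, 3 ^ N.of_nat d - 1)%num | d <- [:: 24; 26; 36; 48; 72]].

Lemma low_modulusE : N.to_nat low_modulus = 3 ^ 13.
Proof. by rewrite -[low_modulus]/(3 ^ 13)%num to_nat_pow. Qed.

Lemma fold_moduliP d m : (d, m) \in fold_moduli ->
  N.to_nat m = (3 ^ d).-1 /\ 24 <= d.
Proof.
have -> : fold_moduli =
    [seq (d, 3 ^ N.of_nat d - 1)%num | d <- [:: 24; 26; 36; 48; 72]].
  by vm_compute.
case/mapP=> d' d'in [-> ->]; split.
  by by rewrite N2Nat.inj_sub to_nat_pow Nat2N.id; lia.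
by move: d'in; rewrite !inE => /or4P[|||/orP[]] /eqP->.
Qed.

(* From the exponent 21 on, the powers of 2 are purely periodic modulo each
   [3 ^ d - 1], whose 2-part is at most 2 ^ 6, and exceed [3 ^ 13]. *)
Definition start := 21.

Definition residue x (m : N) : N := N.modulo (2 ^ N.of_nat x)%num m.

Lemma residueE x m : N.to_nat (residue x m) = 2 ^ x %% N.to_nat m.
Proof. by rewrite to_nat_mod to_nat_pow Nat2N.id. Qed.

Lemma residue_eq x y m :
  residue x m = residue y m <-> 2 ^ x = 2 ^ y %[mod N.to_nat m].
Proof.
rewrite -!residueE; split=> [-> // | /N2Nat.inj //].
Qed.

Definition mulm (m u g : N) : N :=
  if (g =? 1)%num then u else N.modulo (u * g)%num m.

(* Multiplication by g realises the shift of exponents by e modulo m; this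
   allows g to be simplified to 1 even though [2 ^ e] is not 1 modulo even m. *)
Definition shifts e m g := forall x, start <= x ->
  2 ^ x * N.to_nat g = 2 ^ (x + e) %[mod N.to_nat m].

Lemma shifts0 m : shifts 0 m 1%num.
Proof. by move=> x _; rewrite addn0 muln1. Qed.

Lemma to_nat_mulm m u g :
  N.to_nat (mulm m u g) = N.to_nat u * N.to_nat g %[mod N.to_nat m].
Proof.
rewrite /mulm; case: N.eqb_spec => [-> | _]; first by rewrite muln1.
by rewrite to_nat_mod modn_mod N2Nat.inj_mul.
Qed.

Lemma shifts_mulm e f m g h :
  shifts e m g -> shifts f m h -> shifts (e + f) m (mulm m g h).
Proof.
move=> Sg Sh x le_x; rewrite -modnMmr to_nat_mulm modnMmr mulnA.
by rewrite -modnMml Sg // modnMml Sh ?addnA //; lia.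
Qed.

Lemma mulm_residue e m g x : shifts e m g -> start <= x ->
  mulm m (residue x m) g = residue (x + e) m.
Proof.
move=> Sg le_x; apply: N2Nat.inj; rewrite residueE -(Sg x le_x) /mulm.
case: N.eqb_spec => [-> | _]; first by rewrite muln1 residueE.
by rewrite to_nat_mod N2Nat.inj_mul residueE modnMml.
Qed.

(* Turns a multiplier that acts trivially on the residues of the powers 2 ^ x,
   x >= 21, into 1, so that [g = 1] signals that e is a period modulo m. *)
Definition normalize (m g : N) : N :=
  if (mulm m (residue start m) g =? residue start m)%num then 1%num else g.

Lemma shifts_normalize e m g : shifts e m g -> shifts e m (normalize m g).
Proof.
move=> Sg; rewrite /normalize; case: N.eqb_spec => // E x /subnK <-.
move: E; rewrite (mulm_residue _ _ _ _ Sg) // => /residue_eq E.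
by rewrite muln1 -addnA !(expnD 2 (x - _)) -modnMmr -E modnMmr.
Qed.

(** * Tables with one entry per modulus *)

Definition table := (N * seq N)%type.

Definition tabulate (f : N -> N) : table :=
  (f low_modulus, [seq f p.2 | p <- fold_moduli]).

Definition map_table2 (f : N -> N -> N -> N) (s t : table) : table :=
  (f low_modulus s.1 t.1,
   [seq f p.1.2 p.2.1 p.2.2 | p <- zip fold_moduli (zip s.2 t.2)]).

Lemma map_table2E f u v :
  map_table2 f (tabulate u) (tabulate v) = tabulate (fun m => f m (u m) (v m)).
Proof. by []. Qed.

Definition mul_table := map_table2 mulm.

Definition table_one := tabulate (fun=> 1%num).

Definition shift_table e (g : table) := exists2 v : N -> N,
  g = tabulate v & forall m, shifts e m (v m).

Lemma mul_residues e g x : shift_table e g -> start <= x ->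
  mul_table (tabulate (residue x)) g = tabulate (residue (x + e)).
Proof.
case=> v -> Sv le_x; rewrite /mul_table map_table2E /tabulate.
congr (_, _); first exact: mulm_residue.
by apply: eq_map => p; apply: mulm_residue.
Qed.

Lemma shift_table_mul e f g h :
  shift_table e g -> shift_table f h -> shift_table (e + f) (mul_table g h).
Proof.
case=> v -> Sv [w -> Sw]; rewrite /mul_table map_table2E.
by exists (fun m => mulm m (v m) (w m)) => // m; apply: shifts_mulm.
Qed.

(** The second [table_one] is a dummy: [map_table2] serves to supply the modulus to [normalize]. *)
Definition pow_table g r :=
  map_table2 (fun m h _ => normalize m h)
    (iter r (mul_table^~ g) table_one) table_one.

Lemma shift_table_pow e g r : shift_table e g -> shift_table (e * r) (pow_table g r).
Proof.
move=> Sg; have: shift_table (e * r) (iter r (mul_table^~ g) table_one).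
  elim: r => [|r IH]; first by rewrite muln0; exists (fun=> 1%num); last exact: shifts0.
  by rewrite mulnS addnC; apply: shift_table_mul.
case=> v E Sv; exists (fun m => normalize m (v m)); last by move=> m; apply: shifts_normalize.
by rewrite /pow_table E map_table2E.
Qed.

(** * The sieve and its computation *)

Definition subm (m u l : N) : N := (if l <=? u then u - l else u + m - l)%num.

(* A zero residue is rejected: it would need digit sum at least [2 * d]. *)
Definition light d b (h : N) := if h is N0 then false else digsumN d h <= b.

Fixpoint light_folds b l (ps : seq (nat * N)) (us gs : seq N) :=
  match ps, us, gs with
  | (d, m) :: ps', u :: us', g :: gs' =>
    if (g =? 1)%num
    then if light d b (subm m u l) then light_folds b l ps' us' gs' else false
    else light_folds b l ps' us' gs'
  | _, _, _ => true
  end.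

Definition admissible k P (g s : table) :=
  if lowN k s.1 is Some w
  then light_folds (25 - w) (N.modulo s.1 P) fold_moduli s.2 g.2
  else false.

(** A class modulo [e] splits into those of [x], [x + e], ..., [x + (r - 1) * e]. The test is
    applied only if the multiplier for [r * e] is 1 modulo [3 ^ k]. *)
Definition sieve_step (gc : table * seq table) (rk : nat * nat) :=
  let: ((g, c), (r, k)) := (gc, rk) in
  let P := (3 ^ N.of_nat k)%num in
  let g' := pow_table g r in
  let c' := flatten [seq traject (mul_table^~ g) s r | s <- c] in
  (g', if (k <= 13) && (N.modulo g'.1 P =? 1)%num
       then [seq s <- c' | admissible k P g' s] else c').

(* The step [(r, k)] refines x mod e to x mod r * e and tests the k lowest
   ternary digits. The d are chosen because the order of 2 modulo the odd part
   of [3 ^ d - 1] is smooth: 2^2 3^4 5 for d = 24, 2^2 3 5 7 13 73 for d = 26,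
   2^2 3^6 7 13 for d = 36, 2^7 3^4 5 for d = 48, 2^2 3^12 5 7 13 73 for d = 72. *)
Definition stages : seq (nat * nat) :=
  [:: (2, 1); (3, 2); (3, 3); (3, 4); (3, 5); (10, 5); (32, 5); (3, 6); (3, 7);
      (7, 7); (13, 7); (73, 7); (3, 8); (3, 9); (3, 10); (3, 11); (3, 12); (3, 13)].

Definition sieve :=
  foldl sieve_step (tabulate (residue 1), [:: tabulate (residue start)]) stages.

Lemma sieve_empty : nilp sieve.2.
Proof. by vm_cast_no_check (erefl true). Qed.

(** * Representable powers pass the test *)

Lemma to_nat_subm m u l : N.to_nat l < N.to_nat m -> N.to_nat u < N.to_nat m ->
  N.to_nat (subm m u l) < N.to_nat m /\
  N.to_nat (subm m u l) + N.to_nat l = N.to_nat u %[mod N.to_nat m].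
Proof.
move=> lt_l lt_u; rewrite /subm; case: N.leb_spec => le_lu; split; try lia.
  by congr (_ %% _); lia.
by rewrite -[RHS]modnDr; congr (_ %% _); lia.
Qed.

Lemma light_subm d m a u l b : N.to_nat m = (3 ^ d).-1 -> 13 <= d ->
    size a <= b <= 25 -> 0 < sum3 a ->
    N.to_nat l < N.to_nat m -> N.to_nat u < N.to_nat m ->
    N.to_nat u = sum3 a + N.to_nat l %[mod N.to_nat m] ->
  light d b (subm m u l).
Proof.
move=> Em d13 /andP[sab b25] a0 lt_l lt_u Eu.
have [lt_h Eh] := to_nat_subm m u l lt_l lt_u.
have [|c [sc /andP[c0 cM] Ec]] := sum3_fold d a _ a0; first by rewrite (leq_trans _ d13).
have {}Eh : N.to_nat (subm m u l) = sum3 c %[mod N.to_nat m].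
  apply/eqP; rewrite -(eqn_modDr (N.to_nat l)) Eh Eu; apply/eqP.
  by rewrite -modnDml -[in RHS]modnDml Em Ec.
(* The value [3 ^ d - 1] has digit sum [2 * d], at least 26, while [c] has at most 25 terms. *)
have lt_c : sum3 c < N.to_nat m.
  rewrite Em ltn_neqAle cM andbT; apply/eqP => Ec'.
  by have := digsum_le d c; rewrite Ec' digsum_predX; clear -sc sab b25 d13; lia.
move: Eh; rewrite !modn_small // /light => Eh.
case: subm Eh => [|p] Eh; first by rewrite -Eh in c0.
by rewrite digsumNE Eh; apply: leq_trans (digsum_le _ _) (leq_trans sc sab).
Qed.

Lemma light_folds_map b l ps (u v : N -> N) :
    (forall d m, (d, m) \in ps -> v m = 1%num -> light d b (subm m (u m) l)) ->
  light_folds b l ps [seq u p.2 | p <- ps] [seq v p.2 | p <- ps].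
Proof.
elim: ps => // [[d m]] ps IH H /=.
have {}IH := IH (fun d' m' i => H d' m' (mem_behead (i : _ \in behead (_ :: _)))).
by case: N.eqb_spec => // v1; rewrite IH (H d m) ?mem_head.
Qed.

Definition power_sum3 x a :=
  [/\ uniq a, size a <= 25 & sum3 a = 2 ^ x].

Lemma periodic_mod e m :
    (forall x, start <= x -> 2 ^ x = 2 ^ (x + e) %[mod m]) ->
  forall q x, start <= x -> 2 ^ x = 2 ^ (x + e * q) %[mod m].
Proof.
move=> per; elim=> [|q IH] x le_x; first by rewrite muln0 addn0.
by rewrite mulnS addnA -IH ?(leq_trans le_x) ?leq_addr // -per.
Qed.

(** The test consults only moduli of which [e] is a period, where [2 ^ x] agrees with the
    representable [2 ^ (x + e * q)]. *)
Lemma admissible_residues k e q x g a :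
    shift_table e g -> start <= x -> k <= 13 ->
    N.modulo g.1 (3 ^ N.of_nat k)%num = 1%num -> power_sum3 (x + e * q) a ->
  admissible k (3 ^ N.of_nat k)%num g (tabulate (residue x)).
Proof.
case=> v -> Sv le_x k13 /= g1; set y := x + e * q => -[Ua sa Ea].
have le_xy : x <= y by apply: leq_addr.
have per m : v m = 1%num -> 2 ^ x = 2 ^ y %[mod N.to_nat m].
  move=> v1; apply: periodic_mod => // z le_z.
  by have := Sv m z le_z; rewrite v1 muln1.
have dvd_k : 3 ^ k %| N.to_nat low_modulus by rewrite low_modulusE dvdn_exp2l.
have EP : N.to_nat (3 ^ N.of_nat k)%num = 3 ^ k by rewrite to_nat_pow Nat2N.id.
(* The multiplier is known to be 1 only modulo [3 ^ k], not modulo [3 ^ 13]. *)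
have per_k : 2 ^ x = 2 ^ y %[mod 3 ^ k].
  apply: periodic_mod => // z le_z; have E := Sv low_modulus z le_z.
  rewrite -(modn_dvdm (2 ^ (z + e)) dvd_k) -E modn_dvdm // -modnMmr -EP -to_nat_mod g1.
  by rewrite muln1.
have [w [b [lw sab Eb]]] := lowP k a Ua.
have Elow : lowN k (tabulate (residue x)).1 = Some w.
  rewrite lowNE residueE low_modulusE low_mod // -(low_mod k k) // per_k low_mod //.
  by rewrite -Ea.
rewrite /admissible Elow.
set l := N.modulo _ _.
have El : N.to_nat l = 2 ^ y %% 3 ^ k.
  by rewrite /l to_nat_mod residueE EP modn_dvdm.
have lt_l : N.to_nat l < 3 ^ 13.
  have lt_k : 2 ^ y %% 3 ^ k < 3 ^ k by rewrite ltn_mod expn_gt0.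
  by rewrite El (leq_trans lt_k) // leq_exp2l.
(* As [2 ^ 21 = 2097152] exceeds [3 ^ 13 = 1594323], something remains above the low digits, as
   folding requires. *)
have y_big : 3 ^ 13 <= 2 ^ y.
  have le_21 : 3 ^ 13 <= 2 ^ 21 by clear; lia.
  apply: leq_trans le_21 _; rewrite leq_exp2l.
    exact: leq_trans le_x le_xy.
  by [].
have Ey : 2 ^ y = sum3 [seq i + k | i <- b] + N.to_nat l.
  by rewrite sum3_shift El -Ea {1}Eb addnC.
have b0 : 0 < sum3 [seq i + k | i <- b].
  by clear -Ey lt_l y_big; lia.
apply: light_folds_map => d m /fold_moduliP[Em d24] v1.
have lt_m : 3 ^ 13 < N.to_nat m.
  have lt_14 : 3 ^ 13 < (3 ^ 14).-1 by clear; lia.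
  rewrite Em; apply: leq_trans lt_14 _; rewrite -!subn1 leq_sub2r //.
  by rewrite leq_exp2l // (leq_trans _ d24).
apply: (light_subm _ _ [seq i + k | i <- b]) => //.
- by rewrite (leq_trans _ d24).
- by rewrite size_map leq_subr andbT; clear -sab sa; lia.
- exact: ltn_trans lt_l lt_m.
- by rewrite residueE ltn_mod; apply: leq_ltn_trans (leq0n _) lt_m.
by rewrite residueE modn_mod per // Ey.
Qed.

(** * Soundness of the refinement *)

Definition covers e (c : seq table) := forall y a,
  start <= y -> power_sum3 y a ->
  exists x q, [/\ start <= x, y = x + e * q & tabulate (residue x) \in c].

Lemma sieve_step_sound e gc rk : 0 < rk.1 ->
    shift_table e gc.1 -> covers e gc.2 ->
  shift_table (e * rk.1) (sieve_step gc rk).1 /\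
  covers (e * rk.1) (sieve_step gc rk).2.
Proof.
case: gc rk => g c [r k] /= r0 Sg Cc; have Sg' := shift_table_pow e g r Sg.
split=> // y a le_y Ha; have [x [q [le_x Ey xc]]] := Cc y a le_y Ha.
have iter_mul t : iter t (mul_table^~ g) (tabulate (residue x)) =
    tabulate (residue (x + e * t)).
  elim: t => [|t IH]; first by rewrite muln0 addn0.
  rewrite iterS IH (mul_residues e) // ?(leq_trans le_x) ?leq_addr //.
  by rewrite mulnS addnAC addnA.
(* The remainder of [q] modulo [r] selects the subclass that contains [y]. *)
pose x' := x + e * (q %% r).
have le_x' : start <= x' by rewrite (leq_trans le_x) ?leq_addr.
have Ey' : y = x' + e * r * (q %/ r).
  by rewrite Ey /x' {1}(divn_eq q r) mulnDr -!addnA; congr (_ + _); lia.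
exists x', (q %/ r); split=> //.
have x'c : tabulate (residue x') \in
    flatten [seq traject (mul_table^~ g) s r | s <- c].
  apply/flatten_mapP; exists (tabulate (residue x)) => //.
  by apply/trajectP; exists (q %% r); rewrite ?ltn_mod ?iter_mul.
case: ifP => // /andP[k13 /N.eqb_spec g1].
rewrite mem_filter x'c andbT.
by apply: (admissible_residues _ (e * r) (q %/ r) _ _ a); rewrite // -Ey'.
Qed.

Lemma sieve_sound s e gc : all (fun rk => 0 < rk.1) s ->
    shift_table e gc.1 -> covers e gc.2 ->
  exists e', covers e' (foldl sieve_step gc s).2.
Proof.
elim: s e gc => [|rk s IH] e gc /=; first by exists e.
case/andP=> r0 s0 Sg Cc; have [Sg' Cc'] := sieve_step_sound e gc rk r0 Sg Cc.
exact: IH s0 Sg' Cc'.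
Qed.

(** * The possible exponents *)

Lemma power_sum3_lt x a : power_sum3 x a -> x < start.
Proof.
move=> Ha; rewrite ltnNge; apply/negP => le_x.
have [|||e Ce] := sieve_sound stages 1
  (tabulate (residue 1), [:: tabulate (residue start)]); first by [].
- exists (residue 1) => // m y _.
  by rewrite residueE modnMmr expnD.
- move=> y b le_y _; exists start, (y - start).
  by rewrite mul1n subnKC // mem_head.
have [y [q [_ _]]] := Ce x a le_x Ha.
by rewrite -/sieve (nilP sieve_empty).
Qed.

(** For every other exponent below 21, one of the eight lowest ternary digits is 2. *)
Lemma power_sum3_exponent x a : power_sum3 x a -> x \in [:: 0; 2; 8].
Proof.
move=> Ha; have := power_sum3_lt x a Ha; have [Ua _ Ea] := Ha.
have [w [b [lw _ _]]] := lowP 8 a Ua; move: lw; rewrite Ea.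
have -> : low 8 (2 ^ x) = lowN 8 (2 ^ N.of_nat x)%num.
  by rewrite lowNE to_nat_pow Nat2N.id.
by move: x {Ha Ea}; do 21!case=> //.
Qed.

Theorem theorem1p2 :
  (forall x : nat,
     (exists a : seq nat, sum_distinct_pow3 25 x a) <->
     x \in [:: 0; 2; 8]) /\
  (forall a : seq nat,
     [/\ sum_distinct_pow3 25 0 a <-> a = [:: 0],
         sum_distinct_pow3 25 2 a <-> a = [:: 0; 1] &
         sum_distinct_pow3 25 8 a <-> a = [:: 0; 1; 2; 5]]).
Proof.
have S0 : sum_distinct_pow3 25 0 [:: 0] by split; rewrite // unlock.
have S2 : sum_distinct_pow3 25 2 [:: 0; 1] by split; rewrite // unlock.
have S8 : sum_distinct_pow3 25 8 [:: 0; 1; 2; 5] by split; rewrite // unlock.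
have uniq_sum x a b :
    sum_distinct_pow3 25 x b -> sum_distinct_pow3 25 x a <-> a = b.
  move=> Sb; split=> [[_ ltn_a Ea] | -> //]; case: Sb => _ ltn_b Eb.
  by apply: sum3_inj => //; rewrite /sum3 -Ea -Eb.
split=> [x | a]; last by split; apply: uniq_sum.
split=> [[a [/andP[_ sa] ltn_a Ea]] | ].
  by apply: (power_sum3_exponent x a); split=> //; apply: sorted_uniq ltn_a;
    [apply: ltn_trans | apply: ltnn].
by rewrite !inE => /or3P[] /eqP->; eexists; eassumption.
Qed.
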